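(* Let $K$ be a max cone in $\mathbb{R}^n_+$ generated by $S$ (that is, $\operatorname{span}(S)=K$) and let $u\in S$, $u\neq 0$. Then the following are equivalent: (1) $u$ is an extremal in $K$. (2) For some $j\in\operatorname{supp}(u)$, $u(j)$ is minimal in $K(j)$. (3) For some $j\in\operatorname{supp}(u)$, $u(j)$ is minimal in $S(j)$.
   Context: $\mathbb{R}^n_+$ is the set of vectors with nonnegative real entries, ordered componentwise; $a\oplus b=\max(a,b)$, extended componentwise to vectors. A max cone is a subset of $\mathbb{R}^n_+$ closed under $\oplus$ and under multiplication by nonnegative reals. $\operatorname{span}(S)$ is the set of all max combinations $\bigoplus_{x\in S}\lambda_x x$ with $\lambda_x\ge 0$ and only finitely many $\lambda_x\neq 0$; $\operatorname{span}(\emptyset)=\{0\}$. An element $u\in K$ is an extremal in $K$ if $u=v\oplus w$ with $v,w\in K$ implies $u=v$ or $u=w$. $\operatorname{supp}(v)=\{j: v_j>0\}$. For $j\in\operatorname{supp}(v)$, $v(j)=v/v_j$; for $T\subseteq\mathbb{R}^n_+$, $T(j)=\{v(j): v\in T,\ j\in\operatorname{supp}(v)\}$. An element $u$ of a set $T$ is minimal in $T$ if $v\le u$ and $v\in T$ imply $v=u$. *)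

(* Defs.v *)
From HB Require Import structures.
From mathcomp Require Import all_boot all_order all_algebra finmap.
From mathcomp Require Import all_classical all_reals.

Set Implicit Arguments.
Unset Strict Implicit.
Unset Printing Implicit Defensive.

Import Order.TTheory GRing.Theory Num.Theory.
Local Open Scope classical_set_scope.
Local Open Scope ring_scope.

Section MaxAlgebra.
Variables (R : realType) (n : nat).
Implicit Types (u v w : 'rV[R]_n) (j : 'I_n) (K S T : set 'rV[R]_n).

Definition nneg_orthant : set 'rV[R]_n := [set v | v \is a mxOver Num.nneg].

Definition vle v w : Prop := forall j, v 0 j <= w 0 j.

Definition vmax v w : 'rV[R]_n := map2_mx Num.max v w.

Definition max_cone K : Prop :=
  [/\ K `<=` nneg_orthant,
      forall v w, K v -> K w -> K (vmax v w)
    & forall (a : R) v, 0 <= a -> K v -> K (a *: v)].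

(* [F] collects the finitely many generators that may have a nonzero
   coefficient; since the empty combination is [0], [max_span set0 = [set 0]].
   Using [0] as the initial value of the iterated maximum is harmless only when
   [S `<=` nneg_orthant]. *)
Definition max_span S : set 'rV[R]_n :=
  [set v | exists (F : {fset 'rV[R]_n}) (lam : 'rV[R]_n -> R),
      [/\ [set` F] `<=` S, forall x, 0 <= lam x
        & v = \big[vmax/0]_(x <- F) (lam x *: x)]].

Definition extremal_in K u : Prop :=
  K u /\ forall v w, K v -> K w -> u = vmax v w -> u = v \/ u = w.

Definition supp v : set 'I_n := [set j | 0 < v 0 j].

Definition normalize v j : 'rV[R]_n := (v 0 j)^-1 *: v.

Definition normalize_set T j : set 'rV[R]_n :=
  [set normalize v j | v in [set v | T v /\ supp v j]].

Definition minimal_in T u : Prop :=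
  T u /\ forall v, T v -> vle v u -> v = u.

End MaxAlgebra.

(* Main.v *)
(** For (3) => (2), a max combination [v] with [v_j > 0] attains its [j]-th
    coordinate at some generator [x], and then [x(j) <= v(j)].
    For (1) => (2), if [u(j)] fails to be minimal in [K(j)] for every [j] in the
    support, rescaled witnesses [y_j <= u] with [y_j <> u] agree with [u] at [j],
    so [u] is the maximum of the [y_j] and is not extremal. *)
Require Import Defs.
From mathcomp Require Import all_boot all_order all_algebra finmap.
From mathcomp Require Import all_classical all_reals.

Set Implicit Arguments.
Unset Strict Implicit.
Unset Printing Implicit Defensive.

Import Order.TTheory GRing.Theory Num.Theory.
Local Open Scope classical_set_scope.
Local Open Scope ring_scope.

Lemma vmaxE (R : realType) (n : nat) (v w : 'rV[R]_n) (j : 'I_n) :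
  vmax v w 0 j = Num.max (v 0 j) (w 0 j).
Proof. by rewrite mxE. Qed.

Lemma vmaxC (R : realType) (n : nat) (v w : 'rV[R]_n) : vmax v w = vmax w v.
Proof. by apply/rowP => j; rewrite !vmaxE maxC. Qed.

Lemma vle_anti (R : realType) (n : nat) (v w : 'rV[R]_n) :
  vle v w -> vle w v -> v = w.
Proof. by move=> vw wv; apply/rowP => j; apply/le_anti; rewrite vw wv. Qed.

Lemma vle_scale (R : realType) (n : nat) (a : R) (v w : 'rV[R]_n) :
  0 <= a -> vle v w -> vle (a *: v) (a *: w).
Proof. by move=> a_ge0 vw j; rewrite !mxE ler_wpM2l. Qed.

Lemma vle_vmaxl (R : realType) (n : nat) (v w : 'rV[R]_n) : vle v (vmax v w).
Proof. by move=> j; rewrite vmaxE le_max lexx. Qed.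

Lemma big_vmaxE (R : realType) (n : nat) (I : Type) (r : seq I) (P : pred I)
    (f : I -> 'rV[R]_n) (j : 'I_n) :
  (\big[@vmax R n/0]_(i <- r | P i) f i) 0 j =
  \big[Num.max/0]_(i <- r | P i) f i 0 j.
Proof.
by apply: (big_morph (fun v : 'rV[R]_n => v 0 j)) => [v w|]; rewrite ?vmaxE ?mxE.
Qed.

Lemma vle_big_vmax (R : realType) (n : nat) (I : eqType) (r : seq I)
    (f : I -> 'rV[R]_n) (i : I) :
  i \in r -> vle (f i) (\big[@vmax R n/0]_(i <- r) f i).
Proof. by move=> ir j; rewrite big_vmaxE; exact: (le_bigmax_seq _ _ xpredT (fun i => f i 0 j)). Qed.

(** A finite maximum started at [0] equals one of its terms or [0]; positivity rules out the initial
    value. *)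
Lemma big_vmax_attained (R : realType) (n : nat) (I : eqType) (r : seq I)
    (f : I -> 'rV[R]_n) (j : 'I_n) :
  0 < (\big[@vmax R n/0]_(i <- r) f i) 0 j ->
  exists2 i, i \in r & (\big[@vmax R n/0]_(i <- r) f i) 0 j = f i 0 j.
Proof.
rewrite big_vmaxE big_seq.
apply: (big_ind (fun a => 0 < a -> exists2 i, i \in r & a = f i 0 j)).
- by rewrite ltxx.
- by move=> a b Pa Pb; case: (leP a b).
- by move=> i ir _; exists i.
Qed.

Lemma normalizeE (R : realType) (n : nat) (v : 'rV[R]_n) (j : 'I_n) :
  supp v j -> normalize v j 0 j = 1.
Proof. by move=> vj; rewrite mxE mulVf// gt_eqF. Qed.

Lemma normalizeK (R : realType) (n : nat) (v : 'rV[R]_n) (j : 'I_n) :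
  supp v j -> v 0 j *: normalize v j = v.
Proof. by move=> vj; rewrite scalerA mulfV ?scale1r// gt_eqF. Qed.

Lemma normalize_scale (R : realType) (n : nat) (a : R) (v : 'rV[R]_n) (j : 'I_n) :
  0 < a -> normalize (a *: v) j = normalize v j.
Proof.
move=> a_gt0; rewrite /normalize mxE scalerA invfM mulrAC mulVf ?mul1r//.
by rewrite gt_eqF.
Qed.

Lemma minimal_in_sub (R : realType) (n : nat) (A B : set 'rV[R]_n) (u : 'rV[R]_n) :
  A `<=` B -> A u -> minimal_in B u -> minimal_in A u.
Proof. by move=> AB Au [_ umin]; split=> // v /AB; apply: umin. Qed.

Lemma normalize_setS (R : realType) (n : nat) (A B : set 'rV[R]_n) (j : 'I_n) :
  A `<=` B -> normalize_set A j `<=` normalize_set B j.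
Proof. by move=> AB _ [v [/AB Bv vj] <-]; exists v. Qed.

Lemma sub_max_span (R : realType) (n : nat) (S : set 'rV[R]_n) :
  S `<=` @nneg_orthant R n -> S `<=` max_span S.
Proof.
move=> S_nneg x Sx; exists [fset x]%fset, (fun=> 1); split=> //.
- by move=> y /=; rewrite inE => /eqP ->.
- have -> : enum_fset [fset x]%fset = [:: x].
    apply/perm_small_eq => //; apply/uniq_perm => // y.
    by rewrite mem_seq1 -in_fset1.
  apply/rowP => j; rewrite big_cons big_nil vmaxE scale1r mxE max_l//.
  by have /mxOverP := S_nneg _ Sx; apply.
Qed.

Lemma max_span_below (R : realType) (n : nat) (S : set 'rV[R]_n) (v : 'rV[R]_n)
    (j : 'I_n) :
  max_span S v -> supp v j ->
  exists x, [/\ S x, supp x j & vle (normalize x j) (normalize v j)].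
Proof.
move=> [F [lam [FS lam_ge0 ->]]] vj.
have [x xF vjE] := big_vmax_attained vj.
have lxj : 0 < (lam x *: x) 0 j by rewrite -vjE.
have lx : 0 < lam x.
  rewrite lt_neqAle lam_ge0 andbT eq_sym; apply: contraTN lxj => /eqP ->.
  by rewrite scale0r mxE ltxx.
exists x; split; first exact: FS.
- by move: lxj; rewrite mxE pmulr_rgt0.
(* Normalizing ignores the factor [lam x], and [lam x *: x] has the same [j]-th entry as the
   combination, so both sides are divided by the same number. *)
- rewrite -(normalize_scale x j lx) /normalize vjE.
  apply: vle_scale; first by rewrite invr_ge0 ltW.
  exact: (@vle_big_vmax R n _ _ (fun x => lam x *: x)).
Qed.

Lemma minimal_in_max_span (R : realType) (n : nat) (S : set 'rV[R]_n)
    (u : 'rV[R]_n) (j : 'I_n) :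
  S `<=` @nneg_orthant R n ->
  minimal_in (normalize_set S j) u -> minimal_in (normalize_set (max_span S) j) u.
Proof.
move=> S_nneg [Su umin]; split.
  exact: normalize_setS (sub_max_span S_nneg) _ Su.
move=> _ [v [Kv vj] <-] vu.
have [x [Sx xj xv]] := max_span_below Kv vj.
(* From [x(j) <= v(j) <= u], minimality among the normalized generators gives [x(j) = u], hence
   [u <= v(j)]. *)
apply: vle_anti => //.
rewrite -(umin (normalize x j)) //; first by exists x.
by move=> i; apply: le_trans (xv i) (vu i).
Qed.

(** If [u] is the maximum of [v] and [w], one of them attains [u 0 j]. Its normalization at [j] then
    lies below that of [u], and minimality makes the two equal. *)
Lemma minimal_extremal (R : realType) (n : nat) (K : set 'rV[R]_n)
    (u : 'rV[R]_n) (j : 'I_n) :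
  K u -> supp u j -> minimal_in (normalize_set K j) (normalize u j) ->
  extremal_in K u.
Proof.
move=> Ku uj [_ umin].
have main v : K v -> vle v u -> u 0 j = v 0 j -> u = v.
  move=> Kv vu uvj; have vj : supp v j by rewrite /supp /= -uvj.
  rewrite -(normalizeK uj) -(normalizeK vj) -uvj (umin (normalize v j)) //.
    by exists v.
  by rewrite /normalize -uvj; apply: vle_scale; rewrite // invr_ge0 ltW.
split=> // v w Kv Kw uE.
have vu : vle v u by rewrite uE; apply: vle_vmaxl.
have wu : vle w u by rewrite uE vmaxC; apply: vle_vmaxl.
have := congr1 (fun z : 'rV[R]_n => z 0 j) uE; rewrite /= vmaxE.
by case: (leP (v 0 j) (w 0 j)) => _ /main; [right | left]; auto.
Qed.

(** Extends extremality from two terms to finitely many. The induction also carries membership in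
    [K], so that extremality applies to partial maxima; [u <> 0] settles the empty one. *)
Lemma extremal_big_vmax (R : realType) (n : nat) (K : set 'rV[R]_n)
    (u : 'rV[R]_n) (I : Type) (r : seq I) (P : pred I) (f : I -> 'rV[R]_n) :
  max_cone K -> extremal_in K u -> u <> 0 -> (forall i, P i -> K (f i)) ->
  u = \big[@vmax R n/0]_(i <- r | P i) f i -> exists2 i, P i & u = f i.
Proof.
move=> [_ Kmax Kscale] [Ku uext] u0 Kf.
suff [] : K (\big[@vmax R n/0]_(i <- r | P i) f i) /\
  (u = \big[@vmax R n/0]_(i <- r | P i) f i -> exists2 i, P i & u = f i) by [].
apply: (big_ind (fun v => K v /\ (u = v -> exists2 i, P i & u = f i))).
- by split=> //; rewrite -(scale0r u); apply: Kscale.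
- move=> v w [Kv IHv] [Kw IHw]; split; first exact: Kmax.
  by case/(uext _ _ Kv Kw).
- by move=> i Pi; split; [exact: Kf | exists i].
Qed.

Lemma extremal_minimal (R : realType) (n : nat) (K : set 'rV[R]_n)
    (u : 'rV[R]_n) :
  max_cone K -> extremal_in K u -> u <> 0 ->
  exists2 j, supp u j & minimal_in (normalize_set K j) (normalize u j).
Proof.
move=> Kcone uext u0; have [Ku _] := uext; have [Knneg _ Kscale] := Kcone.
apply: contrapT => nomin.
(* Off the support [y] takes the dummy value [0]; the maximum below ranges over the support only. *)
have /choice [y yP] : forall j, exists y, 0 < u 0 j ->
    [/\ K y, vle y u, y 0 j = u 0 j & u <> y].
  move=> j; have [uj|uj] := boolP (0 < u 0 j); last by exists 0.
  apply: contrapT => noy; apply: nomin; exists j => //.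
  split; first by exists u.
  move=> _ [v [Kv vj] <-] vu; apply: contrapT => vNu; apply: noy.
  (* Rescaling the witness [v] to agree with [u] at [j] keeps it below [u], and it differs from [u]
     because scaling by [u 0 j > 0] is injective. *)
  exists (u 0 j *: normalize v j) => _; split.
  - apply: (Kscale); first exact: ltW.
    by apply: (Kscale) => //; rewrite invr_ge0 ltW.
  - by rewrite -[X in vle _ X](normalizeK uj); apply/vle_scale/vu/ltW.
  - by rewrite mxE normalizeE ?mulr1.
  - by rewrite -[LHS](normalizeK uj) => /scalerI uv; apply: vNu; rewrite uv ?gt_eqF.
have uE : u = \big[@vmax R n/0]_(j | 0 < u 0 j) y j.
  apply/rowP => j; rewrite big_vmaxE; have u_ge0 i : 0 <= u 0 i.
    by have /mxOverP := Knneg _ Ku; apply.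
  apply/le_anti/andP; split; last first.
    by apply: bigmax_le => // i /yP [].
  (* On the support [y j] attains [u 0 j]; elsewhere [u 0 j <= 0], and the initial value [0] bounds
     the maximum from below. *)
  have [uj|/le_trans] := ltP 0 (u 0 j); last by apply; apply: bigmax_ge_id.
  have [_ _ <- _] := yP j uj.
  exact: (@le_bigmax_cond _ _ _ _ _ (fun i => 0 < u 0 i) (fun i => y i 0 j)).
have Ky j : 0 < u 0 j -> K (y j) by case/yP.
by have [j /yP []] := extremal_big_vmax Kcone uext u0 Ky uE.
Qed.

Theorem theorem14 (R : realType) (n : nat) (K S : set 'rV[R]_n) (u : 'rV[R]_n)
    (K_cone : max_cone K) (S_nneg : S `<=` @nneg_orthant R n)
    (S_gen : max_span S = K) (Su : S u) (u_neq0 : u <> 0) :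
  (extremal_in K u <->
     exists2 j : 'I_n, supp u j & minimal_in (normalize_set K j) (normalize u j))
  /\
  (extremal_in K u <->
     exists2 j : 'I_n, supp u j & minimal_in (normalize_set S j) (normalize u j)).
Proof.
have SK : S `<=` K by rewrite -S_gen; apply: sub_max_span.
have Ku := SK _ Su.
have KS j : minimal_in (normalize_set S j) (normalize u j) ->
    minimal_in (normalize_set K j) (normalize u j).
  by rewrite -S_gen; apply: minimal_in_max_span.
have ext_min uext := extremal_minimal K_cone uext u_neq0.
split; split=> [|[j uj]].
- exact: ext_min.
- exact: minimal_extremal.
(* Since [u] is itself a generator, minimality in [K(j)] restricts to the subset [S(j)]. *)
- move=> /ext_min [j uj umin]; exists j => //.
  by apply: minimal_in_sub umin; [exact: normalize_setS | exists u].
- by move=> /KS; apply: minimal_extremal.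
Qed.
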